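(* Let $D$ be a strong Mori domain. Then $D$ is a $w$-Hilbert domain if and only if $w\text{-}\dim(D)=1$.
   Context: Let $D$ be an integral domain with quotient field $K$. For a nonzero fractional ideal $I$ of $D$ put $I^{-1}=\{a\in K \mid aI\subseteq D\}$. A Glaz-Vasconcelos ideal (GV-ideal) of $D$ is a (nonzero) finitely generated ideal $J$ of $D$ with $J^{-1}=D$; the set of these is $\mathrm{GV}(D)$. The $w$-envelope of a nonzero fractional ideal $I$ is $I_w=\{a\in K \mid aJ\subseteq I \text{ for some } J\in \mathrm{GV}(D)\}$. An ideal $I$ of $D$ is a $w$-ideal if $I_w=I$; since the $w$-operation is defined only on nonzero fractional ideals, $w$-ideals are nonzero. A maximal $w$-ideal is a proper $w$-ideal that is not properly contained in any proper $w$-ideal; $w\text{-}\mathrm{Max}(D)$ is the set of maximal $w$-ideals of $D$. A prime $w$-ideal is an ideal that is both a prime ideal and a $w$-ideal (in particular, it is nonzero). $D$ is a $w$-Hilbert domain if every prime $w$-ideal of $D$ can be expressed as an intersection of maximal $w$-ideals of $D$. $D$ is a strong Mori domain if it satisfies the ascending chain condition on $w$-ideals. The $w$-dimension of $D$ is $w\text{-}\dim(D)=\sup\{\mathrm{ht}(M)\mid M\in w\text{-}\mathrm{Max}(D)\}$, where $\mathrm{ht}(M)$ is the height of the prime ideal $M$.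
   Formalization: The formal theorem assumes that D is not a field; a field has no proper nonzero ideals, so it is vacuously a strong Mori w-Hilbert domain while w-Max(D) is empty and w-dim(D) is not 1, and the equivalence fails there. *)

(* Defs.v *)
From HB Require Import structures.
From mathcomp Require Import all_boot all_order all_algebra.
From mathcomp Require Import fraction.
From mathcomp Require Import boolp classical_sets constructive_ereal.

Set Implicit Arguments.
Unset Strict Implicit.
Unset Printing Implicit Defensive.

Import Order.TTheory GRing.Theory Num.Theory.
Local Open Scope classical_set_scope.
Local Open Scope ring_scope.

(* Ideals of D are sets [set D], not necessarily proper or nonzero (the
   predicate [idealr_closed] of ring_quotient excludes the unit ideal).
   Subsets of the quotient field K have type [set {fraction D}]. *)

Definition ideal (D : idomainType) (I : set D) : Prop :=
  [/\ I 0,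
      forall x y : D, I x -> I y -> I (x + y)
    & forall a x : D, I x -> I (a * x)].

Definition nonzero_ideal (D : idomainType) (I : set D) : Prop :=
  ideal I /\ exists x : D, I x /\ x != 0.

Definition prime_ideal (D : idomainType) (P : set D) : Prop :=
  [/\ ideal P, P <> setT & forall a b : D, P (a * b) -> P a \/ P b].

Definition finitely_generated (D : idomainType) (I : set D) : Prop :=
  exists (n : nat) (g : 'I_n -> D),
    I = [set \sum_(i < n) c i * g i | c in [set: 'I_n -> D]].

Definition toK (D : idomainType) (I : set D) : set {fraction D} :=
  (@tofrac D) @` I.

Definition inv_ideal (D : idomainType) (I : set {fraction D}) :
    set {fraction D} :=
  [set a | forall x : {fraction D}, I x -> toK setT (a * x)].

Definition GV_ideal (D : idomainType) (J : set D) : Prop :=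
  [/\ nonzero_ideal J, finitely_generated J & inv_ideal (toK J) = toK setT].

(* Total in I; only its values at nonzero fractional ideals are meaningful. *)
Definition w_envelope (D : idomainType) (I : set {fraction D}) :
    set {fraction D} :=
  [set a | exists J : set D,
    GV_ideal J /\ forall j : D, J j -> I (a * tofrac j)].

Definition w_ideal (D : idomainType) (I : set D) : Prop :=
  nonzero_ideal I /\ w_envelope (toK I) = toK I.

Definition w_Max (D : idomainType) : set (set D) :=
  [set M | [/\ w_ideal M, M <> setT
    & forall I : set D, w_ideal I -> I <> setT -> ~ M `<` I]].

Definition prime_w_ideal (D : idomainType) (P : set D) : Prop :=
  prime_ideal P /\ w_ideal P.

Definition w_Hilbert (D : idomainType) : Prop :=
  forall P : set D, prime_w_ideal P ->
    exists F : set (set D), F `<=` @w_Max D /\ P = \bigcap_(M in F) M.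

Definition strong_Mori (D : idomainType) : Prop :=
  forall I : nat -> set D,
    (forall n : nat, w_ideal (I n)) ->
    (forall n : nat, I n `<=` I n.+1) ->
    exists N : nat, forall n : nat, (N <= n)%N -> I n = I N.

(* p 0 `<` p 1 `<` ... `<` p n = P is a chain of primes of length n. *)
Definition prime_chain (D : idomainType) (P : set D) (n : nat)
    (p : nat -> set D) : Prop :=
  [/\ forall i : nat, (i <= n)%N -> prime_ideal (p i),
      forall i : nat, (i < n)%N -> p i `<` p i.+1
    & p n = P].

(* Heights and dimensions live in \bar int, where every set has a supremum
   once 0 is taken as the supremum of the empty set. *)
Definition height (D : idomainType) (P : set D) : \bar int :=
  supremum 0%E [set (n%:Z)%:E | n in
    [set n : nat | exists p : nat -> set D, prime_chain P n p]].

Definition w_dim (D : idomainType) : \bar int :=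
  supremum 0%E [set height M | M in @w_Max D].

(* Main.v *)
(* The residuals (D : Y), Y a subset of K, are w-ideals as soon as they are
   nonzero.  By the ascending chain condition every maximal w-ideal M is of the
   form (D : u) with u in K \ D, which makes M prime.  The chain condition on
   residuals also yields a descending chain condition on intersections of
   maximal w-ideals sharing a nonzero element x, so a nonzero prime that is an
   intersection of maximal w-ideals contains, hence equals, one of them.  Thus
   w-Hilbert means that every prime w-ideal is maximal; as every nonzero prime
   inside a proper w-ideal is again a w-ideal, this says that maximal w-ideals have
   height 1. *)
Require Import Defs.
From mathcomp Require Import all_boot all_order all_algebra.
From mathcomp Require Import constructive_ereal.
From mathcomp Require Import fraction boolp classical_sets.

Set Implicit Arguments.
Unset Strict Implicit.
Unset Printing Implicit Defensive.

Import Order.TTheory GRing.Theory Num.Theory.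
Local Open Scope classical_set_scope.
Local Open Scope ring_scope.

(** * Residuals and the w-operation *)

Section WIdeals.
Variable D : idomainType.
Implicit Types (a b d x : D) (u y : {fraction D}) (I J M P : set D).

Local Notation integral := (toK [set: D]).

Lemma integral_tofrac d : integral (tofrac d).
Proof. by exists d. Qed.

Lemma integralD y z : integral y -> integral z -> integral (y + z).
Proof. by move=> [a _ <-] [b _ <-]; exists (a + b); rewrite ?rmorphD. Qed.

Lemma integralM y z : integral y -> integral z -> integral (y * z).
Proof. by move=> [a _ <-] [b _ <-]; exists (a * b); rewrite ?rmorphM. Qed.

Lemma tofrac_inj : injective (@tofrac D).
Proof. by move=> a b /eqP; rewrite tofrac_eq => /eqP. Qed.

Lemma toKE I d : toK I (tofrac d) <-> I d.
Proof. by split=> [[e Ie /tofrac_inj <-]|Id] //; exists d. Qed.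

Lemma ideal_proper I : ideal I -> I <> setT -> ~ I 1.
Proof.
move=> [_ _ IM] IT I1; apply: IT; apply/seteqP; split=> // d _.
by rewrite -[d]mulr1; apply: IM.
Qed.

Lemma ideal_setT : ideal [set: D].
Proof. by []. Qed.

Definition span (s : seq D) : set D :=
  [set \sum_(i < size s) c i * s`_i | c in [set: 'I_(size s) -> D]].

Lemma span_ideal s : ideal (span s).
Proof.
split.
- by exists (fun=> 0) => //; rewrite big1 // => i _; rewrite mul0r.
- move=> _ _ [c _ <-] [e _ <-]; exists (fun i => c i + e i) => //.
  by rewrite -big_split; apply: eq_bigr => i _; rewrite mulrDl.
- move=> a _ [c _ <-]; exists (fun i => a * c i) => //.
  by rewrite big_distrr; apply: eq_bigr => i _ /=; rewrite mulrA.
Qed.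

Lemma mem_span (s : seq D) d : d \in s -> span s d.
Proof.
move=> ds; have lt_d : (index d s < size s)%N by rewrite index_mem.
exists (fun i => (i == Ordinal lt_d)%:R) => //.
rewrite (bigD1 (Ordinal lt_d)) //= eqxx mul1r nth_index // big1 ?addr0 //.
by move=> i /negbTE ->; rewrite mul0r.
Qed.

Lemma span_sub (s : seq D) I :
  ideal I -> (forall d, d \in s -> I d) -> span s `<=` I.
Proof.
move=> [I0 ID IM] sI _ [c _ <-]; apply: (big_ind I) => // i _.
by apply: IM; apply: sI; apply: mem_nth.
Qed.

(** [(D : Y)] cut down to D; for a single fraction [u] this is its ideal of denominators. *)
Definition residual (Y : set {fraction D}) : set D :=
  [set d | forall y, Y y -> integral (y * tofrac d)].

Lemma residual_ideal Y : ideal (residual Y).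
Proof.
split=> [y _|a b Ya Yb y Yy|a d Yd y Yy].
- by rewrite tofrac0 mulr0 -tofrac0; apply: integral_tofrac.
- by rewrite tofracD mulrDr; apply: integralD; [apply: Ya|apply: Yb].
- rewrite tofracM mulrCA; apply: integralM; first exact: integral_tofrac.
  exact: Yd.
Qed.

Lemma residualS Y Z : Y `<=` Z -> residual Z `<=` residual Y.
Proof. by move=> YZ d Zd y /YZ/Zd. Qed.

Lemma GV_setT : GV_ideal [set: D].
Proof.
split.
- by split; [exact: ideal_setT|exists 1; rewrite oner_eq0].
- exists 1%N, (fun=> 1); apply/seteqP; split=> // d _.
  by exists (fun=> d) => //; rewrite big_ord1 mulr1.
- apply/seteqP; split=> y.
    by move=> /(_ (tofrac 1) (integral_tofrac 1)); rewrite tofrac1 mulr1.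
  by move=> yi z; apply: integralM.
Qed.

(** A fraction carrying a GV-ideal into [I] lies in the inverse of that GV-ideal, which is D; so
    only elements of D need testing. *)
Lemma w_idealP I : nonzero_ideal I ->
  w_ideal I <->
  forall J a, GV_ideal J -> (forall j, J j -> I (a * j)) -> I a.
Proof.
move=> nzI; split=> [[_ wI] J a GVJ aJ|IP].
  apply/toKE; rewrite -wI; exists J; split=> // j /aJ Iaj.
  by rewrite -tofracM; apply/toKE.
split=> //; apply/seteqP; split=> [y [J [GVJ yJ]]|_ [a Ia <-]].
  have : integral y.
    have [_ _ JV] := GVJ; rewrite -JV => _ [j /yJ [i _ yi] <-].
    rewrite -yi; exact: integral_tofrac.
  move=> [a _ ya]; rewrite -ya; apply/toKE; apply: (IP J) => // j /yJ.
  by rewrite -ya -tofracM => /toKE.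
exists setT; split; first exact: GV_setT.
move=> j _; rewrite -tofracM; apply/toKE; rewrite mulrC.
by case: nzI => -[_ _ IM] _; apply: IM.
Qed.

(** If [a J] lies in the residual, then each [y a] lies in the inverse of [J], which is D. *)
Lemma residual_w Y d : residual Y d -> d != 0 -> w_ideal (residual Y).
Proof.
move=> Yd d0; apply/w_idealP; first by split; [exact: residual_ideal|exists d].
move=> J a [_ _ JV] aJ y Yy; rewrite -JV => _ [j Jj <-].
by rewrite -mulrA -tofracM; apply: aJ.
Qed.

Lemma w_ideal_no_GV M J : w_ideal M -> M <> setT -> GV_ideal J -> ~ J `<=` M.
Proof.
move=> wM MT GVJ JM; have [nzM _] := wM.
apply: (ideal_proper nzM.1 MT); move/(w_idealP nzM): wM => /(_ J); apply=> //.
by move=> j /JM; rewrite mul1r.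
Qed.

(** If [a J] lies in [P] but [a] does not, then [J] lies in [P], hence in [M], which is impossible
    for a GV-ideal. *)
Lemma prime_w_sub P M : prime_ideal P -> (exists x, P x /\ x != 0) ->
  w_ideal M -> M <> setT -> P `<=` M -> w_ideal P.
Proof.
move=> [iP PT Pp] nzP wM MT PM; apply/w_idealP => // J a GVJ aJ.
apply: contrapT => nPa; apply: (w_ideal_no_GV wM MT GVJ) => j Jj.
by apply: PM; case: (Pp _ _ (aJ j Jj)).
Qed.

Lemma w_Max_eq M I : w_Max M -> w_ideal I -> ~ I 1 -> M `<=` I -> I = M.
Proof.
move=> [_ _ Mmax] wI I1 MI; apply: contrapT => IM; apply: (Mmax I) => //.
  by move=> IT; apply: I1; rewrite IT.
by split=> // IM'; apply: IM; apply/seteqP.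
Qed.

(** Otherwise the ideal spanned by [s] would be a GV-ideal inside [M]. *)
Lemma finite_residual M (s : seq D) : w_ideal M -> M <> setT ->
  (forall d, d \in s -> M d) -> (exists x, x \in s /\ x != 0) ->
  exists u, ~ integral u /\ forall d, d \in s -> integral (u * tofrac d).
Proof.
move=> wM MT sM [x [xs x0]]; apply: contrapT => nu.
apply: (w_ideal_no_GV wM MT (J := span s)); last first.
  by apply: span_sub => //; case: wM => -[].
split.
- split; first exact: span_ideal.
  by exists x; split=> //; apply: mem_span.
- by exists (size s), (fun i => s`_i).
- apply/seteqP; split=> y; last first.
    by move=> yi _ [d _ <-]; apply: integralM => //; apply: integral_tofrac.
  move=> ys; apply: contrapT => yi; apply: nu; exists y; split=> // d ds.
  by apply: ys; exists d => //; apply: mem_span.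
Qed.

(** * Prime ideals *)

Lemma capset_prime P (s : seq (set D)) : prime_ideal P ->
  (forall M, M \in s -> ideal M) -> foldr setI setT s `<=` P ->
  exists2 M, M \in s & M `<=` P.
Proof.
move=> [iP PT Pp]; elim: s => [|M s IHs] sI /= sP.
  by case: (ideal_proper iP PT); apply: sP.
apply: contrapT => nM.
have capI : ideal (foldr setI setT s).
  have {}sI N : N \in s -> ideal N.
    by move=> Ns; apply: sI; rewrite in_cons Ns orbT.
  elim: s sI {IHs sP nM} => [|N s IHs] sI //=.
  have [N0 ND NM] := sI N (mem_head _ _).
  have [|s0 sD sM] := IHs.
    by move=> L Ls; apply: sI; rewrite in_cons Ls orbT.
  split=> // [x y [Nx sx] [Ny sy]|a x [Nx sx]]; split;
    by [apply: ND|apply: sD|apply: NM|apply: sM].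
have MP : ~ M `<=` P by move=> ?; apply: nM; exists M => //; apply: mem_head.
(* For [a] in [M] outside [P] and [b] in the remaining intersection, [a * b] lies in the whole
   intersection; primality puts [b] in [P], and induction applies. *)
apply: MP => a Ma; apply: contrapT => Pa.
case: IHs => [N Ns|b sb|N Ns NP].
- by apply: sI; rewrite in_cons Ns orbT.
- case: (Pp a b) => //; apply: sP; split; last by case: capI => _ _; apply.
  by rewrite mulrC; case: (sI M (mem_head _ _)) => _ _; apply.
- by apply: nM; exists N => //; rewrite in_cons Ns orbT.
Qed.

Lemma prime_ideal0 : prime_ideal [set (0 : D)].
Proof.
split.
- by split=> [|x y /= -> ->|a x /= ->] //; rewrite ?addr0 ?mulr0.
- by move=> /seteqP[_ /(_ 1 I)] /eqP; rewrite oner_eq0.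
- by move=> a b /= /eqP; rewrite mulf_eq0 => /orP[/eqP|/eqP]; [left|right].
Qed.

Lemma proper0_prime P : prime_ideal P ->
  [set (0 : D)] `<` P <-> exists x, P x /\ x != 0.
Proof.
move=> [[P0 _ _] _ _]; split=> [[_ P0']|[x [Px x0]]].
  apply: contrapT => nx; apply: P0' => x Px /=.
  by apply: contrapT => /eqP x0; apply: nx; exists x.
by split=> [_ -> //|/(_ x Px) /= x_eq0]; rewrite x_eq0 eqxx in x0.
Qed.

(** * Consequences of the chain condition on w-ideals *)

Section StrongMori.
Hypothesis smD : strong_Mori D.

(** Without a maximal element, dependent choice yields a strictly ascending sequence in [S]. *)
Lemma acc_max (S : set (set D)) I : S `<=` @w_ideal D -> S I ->
  exists M, S M /\ forall N, S N -> M `<=` N -> N = M.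
Proof.
move=> Sw SI; apply: contrapT => nmax.
have next (M : {M | S M}) : {N : {N | S N} | sval M `<` sval N}.
  case: M => M SM; apply: cid; apply: contrapT => nN; apply: nmax.
  exists M; split=> // N SN MN; apply: contrapT => NM; apply: nN.
  by exists (exist _ N SN); split=> //= NM'; apply: NM; apply/seteqP.
have [f [_ fS]] := dependent_choice next (exist _ I SI).
have [||N /(_ N.+1 (leqnSn N)) fN] := smD (I := fun n => sval (f n)).
- by move=> n; apply: Sw; apply: svalP.
- by move=> n; have [] := fS n.
- by have [_] := fS N; rewrite fN; apply.
Qed.

Lemma sub_w_Max I : w_ideal I -> I <> setT -> exists M, w_Max M /\ I `<=` M.
Proof.
move=> wI IT.
have [||M [[wM MT IM] Mmax]] :=
    @acc_max [set J | [/\ w_ideal J, J <> setT & I `<=` J]] I.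
- by move=> J [].
- by split.
exists M; split=> //; split=> // J wJ JT [MJ JM]; apply: JM.
by rewrite (Mmax J) //; split=> //; apply: subset_trans MJ.
Qed.

(** A maximal divisorial closure [residual (inv s)], over finite [s] in [M], absorbs [M]; a
    nonintegral [u] in [inv s] then puts [M] inside the proper w-ideal [(D : u)]. *)
Lemma w_Max_residual M : w_Max M ->
  exists u, ~ integral u /\ M = residual [set u].
Proof.
move=> Mmax; have [wM MT _] := Mmax; have [[iM [x [Mx x0]]] _] := wM.
pose inv (s : seq D) := [set y | forall d, d \in s -> integral (y * tofrac d)].
(* Requiring [x] in [s] keeps the residuals nonzero. *)
pose ok (s : seq D) := x \in s /\ forall d, d \in s -> M d.
have res_inv s d : d \in s -> residual (inv s) d by move=> ds y; apply.
have [||_ [[s [xs sM] <-] smax]] := @acc_max [set residual (inv s) | s in ok]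
    (residual (inv [:: x])).
- by move=> _ [s [xs _] <-]; apply: residual_w x0; apply: res_inv.
- exists [:: x] => //; split; first exact: mem_head.
  by move=> d; rewrite inE => /eqP ->.
have Ms : M `<=` residual (inv s).
  (* Adjoining [m] to [s] cannot enlarge the maximal residual. *)
  move=> m Mm; rewrite -(smax (residual (inv (m :: s)))).
  - by apply: res_inv; apply: mem_head.
  - exists (m :: s) => //; split=> [|d]; rewrite inE ?xs ?orbT //.
    by case/orP=> [/eqP -> //|/sM].
  - by apply: residualS => y ys d ds; apply: ys; rewrite inE ds orbT.
have [|u [uD us]] := finite_residual wM MT sM; first by exists x.
have Mu : M `<=` residual [set u] by move=> d /Ms Msd _ ->; apply: Msd.
exists u; split=> //; symmetry; apply: w_Max_eq => //.
  exact: residual_w (Mu x Mx) x0.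
by move=> /(_ u erefl); rewrite tofrac1 mulr1.
Qed.

(** With [M = (D : u)] and [a] outside [M], the residual [(D : u a)] contains [M] and omits 1, so it
    equals [M]; it also contains [b]. *)
Lemma w_Max_prime M : w_Max M -> prime_ideal M.
Proof.
move=> Mmax; have [u [uD Mu]] := w_Max_residual Mmax.
have [[[iM [x [Mx x0]]] _] MT _] := Mmax; split=> // a b Mab.
case: (pselect (M a)) => [|Ma]; [by left|right].
have Mua : M `<=` residual [set u * tofrac a].
  move=> d Md _ ->; rewrite mulrAC; apply: integralM (integral_tofrac a).
  by move: Md; rewrite Mu; apply.
have <- : residual [set u * tofrac a] = M.
  apply: w_Max_eq => //; first exact: residual_w (Mua x Mx) x0.
  move=> /(_ _ erefl); rewrite tofrac1 mulr1 => ua; apply: Ma.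
  by rewrite Mu => _ ->.
by move=> _ ->; rewrite -mulrA -tofracM; move: Mab; rewrite Mu; apply.
Qed.

(* With [x] a common nonzero element, [I] is replaced by the integral residual
   [x (D : I)], so that shrinking [I] enlarges a w-ideal. *)
Lemma w_Max_dcc (F : set (set D)) x : F `<=` @w_Max D -> x != 0 ->
  (forall M, F M -> M x) ->
  exists s : seq (set D), (forall M, M \in s -> F M) /\
    forall M, F M -> foldr setI setT s `<=` M.
Proof.
move=> FMax x0 Fx; have fx0 : tofrac x != 0 by rewrite tofrac_eq0.
pose Y (s : seq (set D)) := [set tofrac i / tofrac x | i in foldr setI setT s].
have [||_ [[s sF <-] smax]] := @acc_max
    [set residual (Y s) | s in [set s | forall M, M \in s -> F M]]
    (residual (Y [::])).
- move=> _ [s _ <-]; apply: (residual_w _ x0) => _ [i _ <-].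
  by rewrite mulfVK //; apply: integral_tofrac.
- by exists [::].
exists s; split=> // M FM; have [u [uD Mu]] := w_Max_residual (FMax M FM).
(* As [x] lies in [M = (D : u)], [u x] is some [c] in D, and multiplying [i / x] by [c] gives
   [u i]. *)
have ux : integral (u * tofrac x).
  by have := Fx M FM; rewrite Mu; apply.
case: ux => c _ cE.
have uxE i : tofrac i / tofrac x * tofrac c = u * tofrac i.
  by rewrite cE mulrACA mulVf // mulr1 mulrC.
have Yc : residual (Y (M :: s)) c.
  by move=> _ [i [Mi _] <-]; rewrite uxE; move: Mi; rewrite Mu; apply.
(* By maximality [c] already lies in [residual (Y s)], so [u] carries the intersection of [s] into
   D. *)
rewrite (smax (residual (Y (M :: s)))) in Yc.
- move=> i si; rewrite Mu => _ ->; rewrite -uxE.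
  by apply: Yc; exists i.
- exists (M :: s) => // N; rewrite inE => /orP[/eqP -> //|]; exact: sF.
- by apply: residualS => _ [i [_ si] <-]; exists i.
Qed.

Lemma w_Hilbert_maximal P : w_Hilbert D -> prime_w_ideal P -> w_Max P.
Proof.
move=> HD pwP; have [pP [[iP [x [Px x0]]] _]] := pwP.
have [F [FMax PF]] := HD P pwP.
have [|s [sF sFM]] := w_Max_dcc FMax x0; first by rewrite PF in Px.
have [||M Ms MP] := @capset_prime P s pP.
- by move=> M /sF /FMax [[[]]].
- by move=> d sd; rewrite PF => M /sFM; apply.
suff -> : P = M by apply: FMax; apply: sF.
by apply/seteqP; split=> //; rewrite PF => d; apply; apply: sF.
Qed.

End StrongMori.
End WIdeals.

(** * Suprema and heights *)

Lemma supremum_max (disp : Order.disp_t) (T : porderType disp) (x0 x : T)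
  (A : set T) : A x -> ubound A x -> supremum x0 A = x.
Proof.
move=> Ax Aub; rewrite /supremum ifF; last first.
  by apply/negbTE/set0P; exists x.
apply: xget_unique => [|y [yub ylb]]; first by split=> // y; apply.
by apply/le_anti; rewrite ylb //= yub.
Qed.

(** A bounded set takes its supremum from [nat], since a finite upper bound of a nonempty [S] is a
    natural number; an unbounded one has [+oo]. *)
Lemma nat_supremum_ereal (S : set nat) : S !=set0 ->
  supremums [set n%:Z%:E%E | n in S] !=set0.
Proof.
move=> [n0 Sn0].
have ubE b : ubound [set n%:Z%:E%E | n in S] b ->
    b = +oo%E \/ exists2 m, ubound S m & b = m%:Z%:E%E.
  case: b => [z| |] bub; [right|by left|]; last first.
    by have := bub _ (ex_intro2 _ _ n0 Sn0 erefl).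
  have := bub _ (ex_intro2 _ _ n0 Sn0 erefl); rewrite lee_fin.
  case: z bub => // m bub _; exists m => // n Sn.
  by have := bub _ (ex_intro2 _ _ n Sn erefl); rewrite lee_fin lez_nat.
have [bS|nbS] := pselect (ubound S !=set0).
  have [k [kub klb]] := nat_supremums_neq0 bS.
  exists k%:Z%:E%E; split=> [_ [n Sn <-]|b /ubE[->|[m mub ->]]].
  - by rewrite lee_fin lez_nat; apply: kub.
  - exact: leey.
  - by rewrite lee_fin lez_nat; apply: klb.
exists +oo%E; split=> [y _|b /ubE[->|[m mub _]]]; [exact: leey|by []|].
by case: nbS; exists m.
Qed.

Lemma height_ge (D : idomainType) (P : set D) n p :
  prime_chain P n p -> (n%:Z%:E <= height P)%E.
Proof.
move=> chp; apply: ge_supremum_Nmem; last by exists n => //; exists p.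
by apply: nat_supremum_ereal; exists n, p.
Qed.

(** Every default case of [supremum] returns 0, so the value 1 is a genuine supremum. *)
Lemma height_le_w_dim1 (D : idomainType) (M : set D) :
  w_dim D = 1%E -> w_Max M -> (height M <= 1)%E.
Proof.
rewrite /w_dim /supremum; case: ifPn => // _.
case: xgetP => // y -> [ub _] y1 MM.
by rewrite -y1; apply: ub; exists M.
Qed.

(** * Chains of primes below maximal w-ideals *)

Theorem theorem2p8 (D : idomainType) (nfD : ~ GRing.field_axiom D)
    (smD : strong_Mori D) :
  w_Hilbert D <-> w_dim D = 1%E.
Proof.
split=> [HD|dim1]; last first.
  move=> P [pP wP]; have [[[P0 _ _] nzP] _] := wP; have [_ PT _] := pP.
  have [M [MM PM]] := sub_w_Max smD wP PT.
  exists [set M]; rewrite bigcap_set1; split=> [_ -> //|].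
  apply: contrapT => neqPM; have := height_le_w_dim1 dim1 MM.
  apply/negP; rewrite -ltNge; apply: (@lt_le_trans _ _ 2%:Z%:E%E) => //.
  (* The chain 0, [P], [M] has length 2; [M] enters as the default value of [nth]. *)
  apply: (@height_ge _ _ _ (fun i => nth M [:: [set 0]; P] i)); split=> //.
  - case=> [|[|[|i]]] //= _; [exact: prime_ideal0|exact: w_Max_prime].
  - case=> [|[|i]] //= _; first exact/proper0_prime.
    by split=> // MP; apply: neqPM; apply/seteqP.
have height1 (M : set D) : w_Max M -> height M = 1%E.
  move=> MM; have [[[iM nzM] _] MT _] := MM; have pM := w_Max_prime smD MM.
  apply: supremum_max.
    exists 1%N => //; exists (fun i => nth M [:: [set 0]] i); split=> //.
    - by case=> [|[|i]] //= _; exact: prime_ideal0.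
    - by case=> [|i] //= _; apply/proper0_prime.
  move=> _ [n [p [pp pS pn]] <-]; rewrite lee_fin lez_nat leqNgt.
  apply/negP; case: n => [|[|n]] // in pp pS pn * => _.
  (* In a chain of length at least 2, the prime just below [M] is nonzero, hence a prime w-ideal,
     hence a maximal w-ideal strictly inside [M]. *)
  have pQ := pp n.+1 (leqnSn _).
  have ltQM : p n.+1 `<` M by rewrite -pn; apply: pS.
  have nzQ : exists x, p n.+1 x /\ x != 0.
    apply/proper0_prime => //; have [[q0 _ _] _ _] := pp n (leqW (leqnSn n)).
    have [pnS pSn] := pS n (leqnSn _).
    by split=> [_ ->|pn0]; [apply: pnS|apply: pSn => d /pn0 ->].
  have wQ : w_ideal (p n.+1).
    by have [wM _ _] := MM; apply: prime_w_sub wM MT (properW ltQM).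
  have [_ _ /(_ M)] := w_Hilbert_maximal smD HD (conj pQ wQ).
  by apply=> //; case: MM.
(* A maximal w-ideal must exist, since the empty supremum is 0: for a nonzero nonunit [x], the
   residual of [x^-1] is the proper w-ideal [x D]. *)
have [x [x0 xU]] : exists x : D, x != 0 /\ x \isn't a GRing.unit.
  apply: contrapT => nx; apply: nfD => x x0; apply: contrapT => /negP xU.
  by apply: nx; exists x.
have xres : residual [set (tofrac x)^-1] x.
  by move=> _ ->; rewrite mulVf ?tofrac_eq0 // -tofrac1; apply: integral_tofrac.
have [|M [MM _]] := sub_w_Max smD (residual_w xres x0).
  move=> /seteqP[_ /(_ 1 I) /(_ _ erefl)]; rewrite tofrac1 mulr1 => -[d _ dx].
  move/negP: xU; apply; apply/unitrPr; exists d; apply: tofrac_inj.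
  by rewrite tofracM dx mulfV ?tofrac_eq0.
apply: supremum_max; first by exists M => //; apply: height1.
by move=> _ [N NN <-]; rewrite height1.
Qed.
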